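(* Let $N$ and $\kappa$ be given and let $\mathbf x_1,\dots,\mathbf x_N$ be samples, $\mathbf x_i=X^i_{1..n_i}$, where the sequences $(X^i_t)_{t\ge1}$, $i=1..N$, have an arbitrary joint distribution such that the marginal distribution of each sequence $(X^i_t)_{t\ge 1}$ is stationary ergodic and is one of $\kappa$ different (unknown) stationary ergodic processes $\rho_1,\dots,\rho_\kappa$. Let $\mathcal G=\{\mathcal G_1,\dots,\mathcal G_\kappa\}$ be the target clustering. Then the farthest-point clustering algorithm (described in the context), provided with the correct number $\kappa$ of clusters, is strongly asymptotically consistent: with probability 1, its output equals $\mathcal G$ from some $n$ on, where $n=\min\{n_1,\dots,n_N\}$.
   Context: The alphabet $A$ is $\mathbb R$ or a finite set. A process is a probability measure on $A^\infty$ with its Borel sigma-algebra. For $\mathbf x=X_{1..n}\in A^n$ and measurable $B\subset A^k$, the frequency is $\nu(\mathbf x,B):=\frac1{n-k+1}\sum_{i=1}^{n-k+1}\mathbf 1\{(X_i,\dots,X_{i+k-1})\in B\}$ if $n\ge k$, and $0$ otherwise. A process $\rho$ is stationary if $\rho(X_{1..j}\in B)=\rho(X_{i..i+j-1}\in B)$ for all $i,j\ge1$ and measurable $B\subset A^j$; it is ergodic if for every $k$ and measurable $B\subset A^k$ the frequency $\nu(X_{1..n},B)$ converges $\rho$-almost surely to a constant; it is stationary ergodic if it is both. Let $w_k:=1/(k(k+1))$. The empirical distributional distance is: for finite $A$, $\hat d(\mathbf x,\mathbf y):=\sum_{k=1}^\infty w_k\sum_{B\in A^k}|\nu(\mathbf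 x,B)-\nu(\mathbf y,B)|$; for $A=\mathbb R$, $\hat d(\mathbf x,\mathbf y):=\sum_{m,l=1}^\infty w_mw_l\sum_{B\in B^{m,l}}|\nu(\mathbf x,B)-\nu(\mathbf y,B)|$, where $B^{m,l}$ is the partition of $\mathbb R^m$ into cubes of dimension $m$ and volume $2^{-ml}$ (side $2^{-l}$), starting at the origin. Target clustering: $\mathcal G=\{\mathcal G_1,\dots,\mathcal G_\kappa\}$ is the partition of $\{1,\dots,N\}$ into $\kappa$ disjoint (nonempty) sets such that $i\in\mathcal G_j$ if and only if the marginal distribution of the sequence generating $\mathbf x_i$ is $\rho_j$. Farthest-point clustering algorithm, on input $\mathbf x_1,\dots,\mathbf x_N$ and $\kappa$: set $c_1:=1$; for $k=2,\dots,\kappa$ set $c_k:=\operatorname{argmax}_{i=1..N}\min_{j=1..k-1}\hat d(\mathbf x_i,\mathbf x_{c_j})$, ties broken arbitrarily. The samples $\mathbf x_{c_1},\dots,\mathbf x_{c_\kappa}$ are the cluster centres. Each remaining index $i\in\{1,\dots,N\}$ is assigned to the cluster $C_k$ whose centre is closest, i.e. $k\in\operatorname{argmin}_{j=1..\kappa}\hat d(\mathbf x_i,\mathbf x_{c_j})$ (ties broken arbitrarily), and $c_k\in C_k$. The output is the partition $\{C_1,\dots,C_\kappa\}$ of $\{1,\dots,N\}$, compared with $\mathcal G$ as an unordered partition. ''From some $n$ on with probability 1'' means: with probability 1 there is a (random) $n_0$ such that the output equals $\mathcal G$ whenever $\min\{n_1,\dots,n_N\}\ge n_0$. *)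

(* Defs.v *)
From HB Require Import structures.
From mathcomp Require Import all_boot all_order all_algebra.
From mathcomp Require Import all_classical all_reals all_analysis.
Import Order.TTheory GRing.Theory Num.Theory.
Import numFieldNormedType.Exports.

Set Implicit Arguments.
Unset Strict Implicit.
Unset Printing Implicit Defensive.

Local Open Scope classical_set_scope.
Local Open Scope ring_scope.

HB.instance Definition _ (I : Type) (T : I -> ptopologicalType) :=
  Pointed.copy (prod_topology T) (forall i, T i).

(* The letter [x0] of a finite alphabet only witnesses that it is nonempty:
   the library's measurable types are pointed, and an empty alphabet carries
   no process. *)
Variant alphabet : Type :=
  | RealAlphabet
  | FiniteAlphabet (F : finType) (x0 : F).

Definition finite_letters (F : finType) (x0 : F) : ptopologicalType :=
  HB.pack_for ptopologicalType (discrete_topology F)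
    (isPointed.Build (discrete_topology F) x0).

Definition letters (R : realType) (a : alphabet) : ptopologicalType :=
  match a with
  | RealAlphabet => R
  | FiniteAlphabet F x0 => finite_letters x0
  end.

Definition borel (T : ptopologicalType) := g_sigma_algebraType (@open T).

(* The spaces A^k and A^oo; coordinates are numbered from 0. *)
Notation words A k := {ptws 'I_k -> A}.
Notation infwords A := {ptws nat -> A}.

Definition block (A : Type) (x : nat -> A) (i k : nat) : 'I_k -> A :=
  fun u => x (i + u)%N.

Definition process (R : realType) (A : ptopologicalType) :=
  probability (borel (infwords A)) R.

(* The values of a library measure outside the sigma-algebra are arbitrary, so
   processes are compared on Borel sets rather than by [=]. *)
Definition same_law (R : realType) (A : ptopologicalType)
    (mu nu : set (borel (infwords A)) -> \bar R) : Prop :=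
  forall B : set (borel (infwords A)), measurable B -> mu B = nu B.

(* The default letter [point] is never read: [i + u < size x] below. *)
Definition freq (R : realType) (A : pointedType) (x : seq A) (k : nat)
    (B : set ('I_k -> A)) : R :=
  if (k <= size x)%N then
    ((size x - k).+1%:R)^-1 *
      \sum_(i < (size x - k).+1) \1_B (@block A (nth point x) i k)
  else 0.

Definition stationary (R : realType) (A : ptopologicalType)
    (rho : process R A) : Prop :=
  forall (i j : nat) (B : set (borel (words A j))), (0 < j)%N -> measurable B ->
    rho [set x | B (@block A x 0 j)] = rho [set x | B (@block A x i j)].

Definition ergodic (R : realType) (A : ptopologicalType)
    (rho : process R A) : Prop :=
  forall (k : nat) (B : set (borel (words A k))), (0 < k)%N -> measurable B ->
    exists c : R, {ae rho, forall x : infwords A,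
      freq R (mkseq x n) B @[n --> \oo] --> c}.

Definition weight (R : realType) (k : nat) : R := ((k * k.+1)%:R)^-1.

(* The half-open cube of R^m of side 2^-l with lower corner 2^-l z. *)
Definition cube (R : realType) (m l : nat) (z : 'I_m -> int) :
    set ('I_m -> R) :=
  [set x | forall u, (z u)%:~R / 2 ^+ l <= x u < (z u + 1)%:~R / 2 ^+ l].

Definition cubes (R : realType) (m l : nat) : set (set ('I_m -> R)) :=
  range (@cube R m l).

Definition dhat_real (R : realType) (x y : seq R) : \bar R :=
  (\sum_(1 <= m <oo) \sum_(1 <= l <oo) (weight R m * weight R l)%:E *
     \esum_(B in @cubes R m l) `|freq R x B - freq R y B|%:E)%E.

Definition dhat_finite (R : realType) (F : finType) (x0 : F)
    (x y : seq (finite_letters x0)) : \bar R :=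
  (\sum_(1 <= k <oo) (weight R k)%:E *
     \sum_(b : {ffun 'I_k -> F})
       `|freq R x [set (b : 'I_k -> F)] - freq R y [set (b : 'I_k -> F)]|%:E)%E.

Definition dhat (R : realType) (a : alphabet) :
    seq (letters R a) -> seq (letters R a) -> \bar R :=
  match a with
  | RealAlphabet => @dhat_real R
  | FiniteAlphabet F x0 => @dhat_finite R F x0
  end.

Section FarthestPoint.
Variables (R : realType) (N kappa : nat) (d : 'I_N -> 'I_N -> \bar R).
Implicit Types (c : 'I_kappa -> 'I_N).
Local Open Scope ereal_scope.

(* Distance of the sample [i] to the centres chosen before step [k]. *)
Definition dist_to_previous c (k : 'I_kappa) (i : 'I_N) : \bar R :=
  \big[mine/+oo]_(j < kappa | (j < k)%N) d i (c j).

Definition farthest_centres c : Prop :=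
  forall k : 'I_kappa,
    if k == 0%N :> nat then c k = 0%N :> nat
    else forall i, dist_to_previous c k i <= dist_to_previous c k (c k).

(* [assign i] is the number of the cluster that receives [i]. The second clause
   says that [c k] belongs to the cluster with centre [c k]; it reads
   [assign (c k) = k] when the centres are distinct, and stays satisfiable when
   a tie makes the algorithm choose the same index twice. *)
Definition nearest_centre c (assign : 'I_N -> 'I_kappa) : Prop :=
  (forall i j, d i (c (assign i)) <= d i (c j)) /\
  (forall k, c (assign (c k)) = c k).

(* The outputs the algorithm may return, over all ways of breaking ties. *)
Definition farthest_point_output (out : {set {set 'I_N}}) : Prop :=
  exists c assign, [/\ farthest_centres c, nearest_centre c assign &
    out = [set [set i | assign i == k] | k : 'I_kappa]%SET].

(* The algorithm always has an output. The hypothesis on the diagonal holds for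
   any distance. *)
Lemma farthest_point_output_exists : (0 < N)%N -> (0 < kappa)%N ->
  (forall i j, d i i <= d i j) -> exists out, farthest_point_output out.
Proof.
move=> N0 k0 dii; pose i0 := Ordinal N0; pose j0 := Ordinal k0.
pose next (s : seq 'I_N) : 'I_N :=
  if s is [::] then i0
  else [arg max_(i > i0) (\big[mine/+oo]_(j <- s) d i j)%E]%O.
pose centres m := iter m (fun s => rcons s (next s)) [::].
pose c (k : 'I_kappa) := next (centres k).
have centresE m : centres m = [seq next (centres j) | j <- iota 0 m].
  elim: m => // m IH; rewrite -addn1 iotaD map_cat -IH /= add0n cats1 addn1.
  by rewrite -/(centres m).
have distE (k : 'I_kappa) i :
    dist_to_previous c k i = \big[mine/+oo]_(j <- centres k) d i j.
  rewrite centresE big_map -[k in iota 0 k]subn0 -/(index_iota 0 k) big_mkord.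
  rewrite /dist_to_previous.
  rewrite (big_ord_widen _ (fun j => d i (next (centres j)))
    (ltnW (ltn_ord k))).
  by apply: eq_bigr.
have farc : farthest_centres c.
  move=> k; case: ifPn => [/eqP kE|kn0 i]; first by rewrite /c kE.
  rewrite !distE /c; case: (centres k) (centresE k) => [|x s _].
    by case: (val k) kn0.
  rewrite /next; case: arg_maxP => // i1 _; exact.
pose isc i := [pick k | c k == i].
pose assign i := if isc i is Some k then k
  else [arg min_(k < j0) d i (c k)]%O.
have assignc k : c (assign (c k)) = c k.
  by rewrite /assign /isc; case: pickP => [k' /eqP //|/(_ k)]; rewrite eqxx.
exists [set [set i | assign i == k] | k : 'I_kappa]%SET, c, assign; split=> //.
split=> // i j; rewrite /assign /isc;
  case: pickP => [k /eqP ->|_]; first exact: dii.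
by case: arg_minP => // k _; exact.
Qed.

End FarthestPoint.

(* Main.v *)
Require Import Defs.
From HB Require Import structures.
From mathcomp Require Import all_boot all_order all_algebra finmap.
From mathcomp Require Import all_classical all_reals all_analysis.
From mathcomp Require Import ring lra zify measurable_realfun.
Import Order.TTheory GRing.Theory Num.Theory.
Import numFieldNormedType.Exports.
Local Open Scope classical_set_scope.
Local Open Scope ring_scope.

Set Implicit Arguments.
Unset Strict Implicit.
Unset Printing Implicit Defensive.

(** Both alphabets are treated at once. The empirical distance is the weighted
    l1 distance between two families of numbers indexed by pairs (partition,
    cell): the weighted frequencies of the cells in either sample. The same
    formula makes sense for the weighted probabilities of the cells under a
    process, so samples and processes live in one space with one pseudometric
    [grid_dist]. A [grid] records what the argument needs to know about the
    partitions: summable positive weights, countably many disjoint measurable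
    cells covering the space, and a sequence of finer and finer partitions whose
    cells shrink to points.

    Almost surely every sample converges, in this pseudometric, to the process
    that generates it ([empirical_profile_cvg]). For one cell, ergodicity says
    that the frequency converges almost surely to a constant; the expected
    frequency is the probability of the cell by stationarity, so bounded
    convergence identifies the constant ([freq_cvg_law]). There are countably
    many cells, hence all of them converge simultaneously almost surely. Passing
    from convergence of each term to convergence of the infinite sum is
    Scheffe's lemma ([scheffe]): the limits carry the total mass of the weights,
    and the frequencies never carry more.

    Different processes are at positive distance ([law_profile_dist_gt0]): an
    open set is the increasing union, over the levels, of the cells that it
    contains, so the probabilities of the cells determine those of the open
    sets, which form a pi-system generating the Borel sets.

    Let delta bound from below the distances between distinct processes. Once
    each sample is within delta/4 of its process, two samples of the same
    process are less than delta/2 apart, and two samples of different processes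
    at least delta/2 apart. In that situation the farthest-point algorithm
    cannot err ([farthest_point_separated]): as long as some cluster has no
    centre, the farthest sample comes from such a cluster, and each sample is
    then closest to the centre from its own cluster. *)

(** * Farthest-point clustering of separated points *)

(** The centres picked before step k cover at most k < kappa clusters, so some
    sample is at distance at least t from all of them; the farthest sample then
    is so too, and belongs to a new cluster. Hence the centres are in bijection
    with the clusters, and a sample is strictly closer to the centre of its own
    cluster than to any other. *)
Lemma farthest_point_separated (R : realType) (N kappa : nat)
    (d : 'I_N -> 'I_N -> \bar R) (t : \bar R) (g : 'I_N -> 'I_kappa)
    (out : {set {set 'I_N}}) :
  (forall k, exists i, g i = k) ->
  (forall i i', g i = g i' -> (d i i' < t)%E) ->
  (forall i i', g i != g i' -> (t <= d i i')%E) ->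
  farthest_point_output kappa d out ->
  out = [set [set i | g i == k] | k : 'I_kappa]%SET.
Proof.
move=> g_surj near_t far_t [c [assign [farc [nearest _] ->]]].
have far_prev (k : 'I_kappa) i :
    (t <= dist_to_previous d c k i)%E ->
    forall j : 'I_kappa, (j < k)%N -> g i != g (c j).
  move=> + j jk; rewrite /dist_to_previous (bigD1 j)//= => /le_trans H.
  apply/eqP => /near_t; rewrite ltNge => /negP; apply; apply: H.
  by rewrite ge_min lexx.
(* Centres lie in different clusters, by pigeonhole on the first [k]. *)
have gc_neq (j k : 'I_kappa) : (j < k)%N -> g (c j) != g (c k).
  move=> jk; rewrite eq_sym; apply: (far_prev k) => //.
  have [k' k'P] : exists k',
      k' \notin [set g (c j) | j : 'I_kappa & (j < k)%N]%SET.
    apply/existsP; rewrite -negb_forall; apply/negP => /forallP all_in.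
    have : (kappa <= k)%N.
      rewrite -[leqLHS]card_ord -cardsT.
      apply: leq_trans (subset_leq_card _) (leq_trans (leq_imset_card _ _) _).
      - by apply/fintype.subsetP => k' _; move/negPn: (all_in k').
      - rewrite -sum1_card; under eq_bigl do rewrite inE.
        rewrite -(big_ord_widen _ (fun=> 1%N) (ltnW (ltn_ord k))).
        by rewrite sum1_card card_ord.
    by rewrite leqNgt ltn_ord.
  have [i gi] := g_surj k'.
  have := farc k; rewrite ifF; last by case: (k : nat) jk.
  move=> /(_ i); apply: le_trans.
  rewrite /dist_to_previous; elim/big_ind: _ => [|x y xt yt|j' j'k].
  - exact: leey.
  - by rewrite le_min xt yt.
  - apply: far_t; rewrite gi; apply: contraNneq k'P => ->.
    by apply/imsetP; exists j' => //; rewrite inE.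
have gc_inj : injective (g \o c).
  move=> j k /= gjk; apply: val_inj.
  by case: (ltngtP j k) => // /gc_neq; rewrite gjk eqxx.
have [gc' gcK gc'K] := injF_bij gc_inj.
have gcE i : g (c (assign i)) = g i.
  apply/eqP; apply: contraT; rewrite eq_sym => /far_t.
  rewrite leNgt => /negP[].
  apply: le_lt_trans (nearest i (gc' (g i))) _; apply: near_t.
  by rewrite -[LHS]gc'K.
apply/setP => S; apply/imsetP/imsetP => -[k _ ->].
  exists (g (c k)) => //; apply/setP => i; rewrite !inE -gcE.
  by rewrite (inj_eq gc_inj).
exists (gc' k) => //; apply/setP => i; rewrite !inE -gcE.
by rewrite -[k in LHS]gc'K (inj_eq gc_inj).
Qed.

(** * Scheffe's lemma for infinite sums *)

(** The excess of f over p is controlled by the deficit, because f has no more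
    total mass than p: adding up |f - p| = (f - p) + 2 (p - f)^+ bounds the l1
    distance by twice the mass of (p - f)^+. This deficit is dominated by p,
    hence small outside a finite set, and on a finite set pointwise convergence
    suffices. *)
Lemma scheffe (R : realType) (T : choiceType) (K : set T)
    (p : T -> R) (f : nat -> T -> R) :
  (forall c, K c -> 0 <= p c) ->
  (forall n c, K c -> 0 <= f n c) ->
  (\esum_(c in K) (p c)%:E < +oo)%E ->
  (forall n, (\esum_(c in K) (f n c)%:E <= \esum_(c in K) (p c)%:E)%E) ->
  (forall c, K c -> f n c @[n --> \oo] --> p c) ->
  forall e : R, 0 < e ->
  \forall n \near \oo, (\esum_(c in K) `|f n c - p c|%:E < e%:E)%E.
Proof.
move=> p0 f0 pfin fp fcvg e e0.
have pE0 c : K c -> (0 <= (p c)%:E)%E by rewrite lee_fin => /p0.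
have fE0 n c : K c -> (0 <= (f n c)%:E)%E by rewrite lee_fin => /(f0 n).
have p_num : (\esum_(c in K) (p c)%:E)%E \is a fin_num.
  by rewrite ge0_fin_numE// esum_ge0.
(* This is twice the positive part of [p - f n]. *)
pose h n c : R := `|f n c - p c| + (p c - f n c).
have h0 n c : (0 <= (h n c)%:E)%E.
  rewrite lee_fin /h distrC; have := ler_norm (- (p c - f n c)).
  by rewrite normrN; lra.
have le_h n : (\esum_(c in K) `|f n c - p c|%:E <=
    \esum_(c in K) (h n c)%:E)%E.
  rewrite -(leeD2rE _ _ p_num) -esumD//.
  apply: (@le_trans _ _
    (\esum_(c in K) (h n c)%:E + \esum_(c in K) (f n c)%:E)%E).
    rewrite -esumD//; last exact: fE0.
    by apply: le_esum => c _; rewrite -!EFinD lee_fin /h; lra.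
  exact: leeD2l.
have e4 : 0 < e / 4%:R by rewrite divr_gt0.
have [F [finF FK] Fbig] : exists2 F, fsets K F &
    (\esum_(c in K) (p c)%:E - (e / 4%:R)%:E < \sum_(c \in F) (p c)%:E)%E.
  have : (\esum_(c in K) (p c)%:E - (e / 4%:R)%:E < \esum_(c in K) (p c)%:E)%E.
    by rewrite lteBlDr// lteDl// lte_fin.
  by move=> /ereal_sup_gt[_ [F KF <-]]; exists F.
have tail n : (\esum_(c in K `&` ~` F) (h n c)%:E < (e / 2%:R)%:E)%E.
  have pF_num : (\sum_(c \in F) (p c)%:E)%E \is a fin_num.
    by rewrite fsumEFin.
  have ptail : (\esum_(c in K `&` ~` F) (p c)%:E < (e / 4%:R)%:E)%E.
    move: Fbig; rewrite lteBlDr// (esumID F)// (setIidr FK) (esum_fset finF).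
      by rewrite lteD2lE.
    by move=> c /[!inE]/FK; exact: pE0.
  apply: (@le_lt_trans _ _
    (\esum_(c in K `&` ~` F) ((p c)%:E + (p c)%:E))%E).
    apply: le_esum => c [Kc _]; rewrite -EFinD lee_fin.
    have := p0 _ Kc; have := f0 n _ Kc; rewrite /h.
    by case: (ger0P (f n c - p c)); lra.
  rewrite esumD; try by move=> c [+ _]; exact: pE0.
  apply: lt_le_trans (lteD ptail ptail) _.
  by rewrite -EFinD lee_fin; lra.
have near_F : \forall n \near \oo, \sum_(c <- fset_set F) h n c < e / 2%:R.
  have : \sum_(c <- fset_set F) h n c @[n --> \oo] -->
      \sum_(c <- fset_set F) (0 : R).
    rewrite [X in X @ _ --> _](_ : _ = fun n =>
      \sum_(c <- fset_set F | c \in F) h n c); last first.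
      apply/funext => n; rewrite big_seq_cond [RHS]big_seq_cond.
      by apply: eq_bigl => c; rewrite in_fset_set// andbT andbb.
    rewrite [X in _ --> X](_ : _ = \sum_(c <- fset_set F | c \in F) (0 : R)).
      apply: cvg_big => [|c /[!inE]/FK Kc]; first exact: add_continuous.
      have -> : (0 : R) = `|p c - p c| + (p c - p c) by rewrite subrr normr0 addr0.
      apply: cvgD; first apply: cvg_norm; apply: cvgB;
        solve [exact: cvg_cst|exact: fcvg].
    by rewrite !big1.
  by rewrite big1// => /cvgr_lt; apply; rewrite divr_gt0.
near=> n.
apply: le_lt_trans (le_h n) _.
rewrite (esumID F)// [in ltRHS](_ : e = e / 2%:R + e / 2%:R); last by lra.
rewrite EFinD lteD// setIidr// esum_fset//.
by rewrite fsbig_finite//= sumEFin lte_fin; near: n.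
Unshelve. all: by end_near. Qed.

(** * Frequencies under a stationary ergodic process *)

(** Subbasic neighbourhoods suffice: the topology is the supremum of the
    topologies pulled back along the coordinates. *)
Lemma cvg_ptws (I : Type) (A : topologicalType)
    (F : set_system {ptws I -> A}) (x : {ptws I -> A}) : Filter F ->
  (forall i (V : set A), open V -> V (x i) -> F [set y | V (y i)]) ->
  F --> x.
Proof.
move=> FF FV; apply/cvg_sup => i U [_ [[V oV <-] Vx] VU].
by apply: filterS VU _; exact: FV.
Qed.

Lemma continuous_borel_measurable (T T' : ptopologicalType) (f : T -> T') :
  continuous f -> measurable_fun setT (f : borel T -> borel T').
Proof.
move=> /continuousP cf.
apply: (@measurability _ _ (borel T) (borel T') setT f (@open T')) => //.
move=> _ [V oV <-]; rewrite setTI; apply: sub_sigma_algebra; exact: cf.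
Qed.

Lemma block_continuous (A : ptopologicalType) (i k : nat) :
  continuous (fun x : infwords A => @block A x i k : words A k).
Proof.
move=> x; apply: cvg_ptws => u V oV Vx.
apply: (@proj_continuous nat (fun=> A) (i + u)%N x).
exact: open_nbhs_nbhs.
Qed.

Section process.
Variables (R : realType) (A : ptopologicalType).

(** The cylinder over [B] with base at time [i]. *)
Definition block_event (k : nat) (B : set (words A k)) (i : nat) :
  set (borel (infwords A)) := [set x | B (@block A x i k)].

Lemma measurable_block_event k (B : set (borel (words A k))) i :
  measurable B -> measurable (@block_event k B i).
Proof.
move=> mB; rewrite -[X in measurable X]setTI.
exact: (continuous_borel_measurable (@block_continuous A i k)).
Qed.

Lemma freq_mkseq (x : infwords A) n k (B : set (words A k)) : (k <= n)%N ->
  freq R (mkseq x n) B = ((n - k).+1%:R)^-1 *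
    \sum_(i < (n - k).+1) \1_(block_event B i) x.
Proof.
move=> kn; rewrite /freq size_mkseq kn; congr (_ * _); apply: eq_bigr => i _.
rewrite !indicE; suff -> : @block A (nth point (mkseq x n)) i k = @block A x i k.
  by congr ((nat_of_bool _)%:R); apply/idP/idP; rewrite !inE.
apply/funext => u; rewrite /block nth_mkseq//.
by have := ltn_ord i; have := ltn_ord u; lia.
Qed.

Lemma freq_ge0 (x : seq A) k (B : set (words A k)) : 0 <= freq R x B.
Proof.
by rewrite /freq; case: ifP => // _; rewrite mulr_ge0 ?invr_ge0// sumr_ge0.
Qed.

(** Each position in the sample contributes to at most one of the sets [B c]. *)
Lemma sum_freq_le1 (T : Type) (s : seq T) (x : seq A) k
    (B : T -> set (words A k)) :
  (forall y, \sum_(c <- s) \1_(B c) y <= 1 :> R) ->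
  \sum_(c <- s) freq R x (B c) <= 1.
Proof.
move=> B1; rewrite /freq; case: (k <= size x)%N; last by rewrite big1_eq.
rewrite -mulr_sumr exchange_big/= ler_pdivrMl// mulr1.
apply: (@le_trans _ _ (\sum_(i < (size x - k).+1) 1)); first exact: ler_sum.
by rewrite sumr_const card_ord.
Qed.

Lemma freq_le1 (x : seq A) k (B : set (words A k)) : freq R x B <= 1.
Proof.
have := @sum_freq_le1 _ [:: tt] x k (fun=> B); rewrite !big_seq1; apply=> y.
by rewrite big_seq1 indicE lern1 leq_b1.
Qed.

Lemma measurable_freq n k (B : set (borel (words A k))) : measurable B ->
  measurable_fun setT (fun x : borel (infwords A) => freq R (mkseq x n) B).
Proof.
move=> mB; have [kn|nk] := leqP k n; last first.
  rewrite (_ : (fun _ => _) = cst 0)//; apply/funext => x.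
  by rewrite /freq size_mkseq leqNgt nk.
rewrite (_ : (fun _ => _) = (fun x : borel (infwords A) =>
    ((n - k).+1%:R)^-1 * \sum_(i < (n - k).+1) \1_(block_event B i) x)); last first.
  by apply/funext => x; rewrite freq_mkseq.
apply: measurable_funM => //; apply: measurable_sum => i.
exact: measurable_indic (measurable_block_event _ _).
Qed.

Lemma integral_freq (rho : process R A) n k (B : set (borel (words A k))) :
  stationary rho -> (0 < k <= n)%N -> measurable B ->
  (\int[rho]_x (freq R (mkseq x n) B)%:E = rho (block_event B 0))%E.
Proof.
move=> srho /andP[k0 kn] mB.
rewrite (@eq_integral _ _ _ rho setT (fun x => ((n - k).+1%:R^-1)%:E *
    \sum_(i < (n - k).+1) (\1_(block_event B i) x)%:E)%E); last first.
  by move=> x _; rewrite freq_mkseq// EFinM -sumEFin.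
rewrite ge0_integralZl_EFin//; last 2 first.
- by move=> x _; rewrite sume_ge0// => i _; rewrite lee_fin.
- apply: emeasurable_sum => i; apply/measurable_EFinP.
  exact: measurable_indic (measurable_block_event _ _).
rewrite ge0_integral_sum//; last first.
  move=> i; apply/measurable_EFinP.
  exact: measurable_indic (measurable_block_event _ _).
rewrite (eq_bigr (fun=> rho (block_event B 0))); last first.
  move=> i _; rewrite integral_indic// ?setIT; last first.
    exact: measurable_block_event.
  by symmetry; exact: (srho i k B).
rewrite -(@fineK _ (rho (block_event B 0))) ?fin_num_measure//; last first.
  exact: measurable_block_event.
rewrite sumEFin -EFinM sumr_const card_ord -[X in _ * X]mulr_natl mulrA mulVf//.
by rewrite mul1r.
Qed.

(** The frequencies are bounded by 1, so the almost sure limit provided by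
    ergodicity is also the limit of the expected frequencies, all of which equal
    the probability of [B] once n is at least k. *)
Lemma freq_cvg_law (rho : process R A) k (B : set (borel (words A k))) :
  stationary rho -> ergodic rho -> (0 < k)%N -> measurable B ->
  {ae rho, forall x : infwords A,
    freq R (mkseq x n) B @[n --> \oo] --> fine (rho (block_event B 0))}.
Proof.
move=> srho erho k0 mB; have [c cP] := erho k B k0 mB.
suff <- : c = fine (rho (block_event B 0)) by [].
pose L := rho (block_event B 0).
have Lfin : L \is a fin_num.
  by apply: fin_num_measure; exact: measurable_block_event.
suff : L = c%:E by rewrite -/L => ->.
have [] := @dominated_convergence _ _ _ rho setT measurableT
  (fun n x => (freq R (mkseq x n) B)%:E) (cst c%:E) (cst 1%E).
- by move=> n; apply/measurable_EFinP; exact: measurable_freq.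
- exact: measurable_cst.
- apply: (@filterS _ _ (ae_filter_ringOfSetsType rho)) cP => x xc _.
  by apply: cvg_EFin; [exact: nearW|exact: xc].
- exact: finite_measure_integrable_cst.
- by apply: aeW => x n _; rewrite gee0_abs lee_fin ?freq_ge0 ?freq_le1.
move=> _ _; rewrite integral_cst//.
rewrite [X in (_ * X)%E](_ : _ = 1%E) ?mule1 => [cvg_c|];
  last exact: probability_setT.
have cvg_L : [sequence \int[rho]_x (freq R (mkseq x n) B)%:E]_n%E @ \oo --> L.
  apply: cvg_near_cst; near=> n; apply: integral_freq => //.
  by rewrite k0; near: n; exact: nbhs_infty_ge.
exact: (cvg_unique _ cvg_L cvg_c).
Unshelve. all: by end_near. Qed.
End process.

(** * Grids and the cylinders that they define *)

Section countable_unions.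
Context d (T : measurableType d) (R : realType) (I : countType).
Implicit Types (D : set I) (F : I -> set T).

Lemma countable_bigcup_measurable D F :
  (forall i, D i -> measurable (F i)) -> measurable (\bigcup_(i in D) F i).
Proof.
move=> mF; rewrite bigcup_mkcond; apply: countable_bigcupT_measurable => [|i].
  exact: countableP.
by case: ifPn => // /set_mem/mF.
Qed.

(** Reindexing along the injection of [I] into nat reduces this to additivity
    over sequences of sets. *)
Lemma measure_bigcup_esum (mu : {measure set T -> \bar R}) D F :
  (forall i, D i -> measurable (F i)) -> trivIset D F ->
  mu (\bigcup_(i in D) F i) = (\esum_(i in D) mu (F i))%E.
Proof.
move=> mF tF.
pose F' n := if (choice.unpickle n : option I) is Some i then F i else set0.
have F'K i : F' (choice.pickle i) = F i by rewrite /F' choice.pickleK.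
have pickle_inj : set_inj D (choice.pickle : I -> nat).
  by move=> i j _ _; exact: (pcan_inj choice.pickleK).
rewrite -(eq_bigcupr (fun i _ => F'K i)) -(bigcup_image _ choice.pickle F').
rewrite measure_bigcup; last 2 first.
- by move=> _ [i Di <-]; rewrite F'K; exact: mF.
- move=> _ _ [i Di <-] [j Dj <-]; rewrite !F'K => ij.
  by rewrite (tF i j).
rewrite nneseries_esum//.
rewrite (_ : [set x | x \in _] = choice.pickle @` D); last exact: set_mem_set.
by rewrite esum_image//; apply: eq_esum => i _; rewrite F'K.
Qed.

End countable_unions.

(** A family of partitions of the word spaces, one for each scale. The cells of
    the partition at scale [i] are named by codes in a countable type common to
    all scales, so that the pairs (scale, cell) form a countable index set.
    The partitions [level k] are nested and their cells shrink to
    points: this is what lets the cells determine a law. *)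
Record grid (R : realType) (A : ptopologicalType) := Grid {
  scale : countType;
  code : countType;
  scales : set scale;
  weights : scale -> R;
  width : scale -> nat;
  codes : scale -> set code;
  cell : forall i, code -> set (words A (width i));
  weights_gt0 : forall i, scales i -> 0 < weights i;
  weights_summable : (\esum_(i in scales) (weights i)%:E < +oo)%E;
  width_gt0 : forall i, scales i -> (0 < width i)%N;
  measurable_cell : forall i c,
    measurable (@cell i c : set (borel (words A (width i))));
  cell_disjoint : forall i, trivIset (codes i) (@cell i);
  cell_cover : forall i, \bigcup_(c in codes i) @cell i c = setT;
  level : nat -> scale;
  level_scale : forall k, scales (level k);
  level_refine : forall k c, codes (level k.+1) c ->
    exists2 c', codes (level k) c' &
    block_event (@cell (level k.+1) c) 0 `<=` block_event (@cell (level k) c') 0;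
  level_fine : forall (x : infwords A) t (V : set A), open V -> V (x t) ->
    exists k, forall c, codes (level k) c ->
      block_event (@cell (level k) c) 0 x ->
      block_event (@cell (level k) c) 0 `<=` [set y | V (y t)]
}.

Section grid_theory.
Variables (R : realType) (A : ptopologicalType) (g : grid R A).

Definition cyl (i : scale g) (c : code g) : set (borel (infwords A)) :=
  block_event (@cell _ _ g i c) 0.

Lemma measurable_cyl i c : measurable (cyl i c).
Proof. by apply: measurable_block_event; exact: measurable_cell. Qed.

Lemma cyl_disjoint i : trivIset (codes i) (cyl i).
Proof.
move=> c c' ic ic' [x [xc xc']]; apply: (cell_disjoint ic ic').
by exists (@block A x 0 (width i)).
Qed.

Lemma cyl_cover i x : exists2 c, codes i c & cyl i c x.
Proof.
have : setT (@block A x 0 (width i) : words A (width i)) by [].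
by rewrite -(cell_cover i) => -[c ic xc]; exists c.
Qed.

(** The sets of points sharing a cell of level k with x decrease with k, so they
    generate a filter; it converges to x because it does so coordinatewise. *)
Lemma cyl_base (x : infwords A) (U : set (infwords A)) : open U -> U x ->
  exists k, forall c, codes (level g k) c -> cyl (level g k) c x ->
  cyl (level g k) c `<=` U.
Proof.
move=> oU Ux.
pose near k : set (infwords A) := [set y | exists c,
  [/\ codes (level g k) c, cyl (level g k) c x & cyl (level g k) c y]].
have nearS k : near k.+1 `<=` near k.
  move=> y [c [kc xc yc]]; have [c' kc' cc'] := level_refine kc.
  by exists c'; split=> //; exact: cc'.
have near_le k k' : (k <= k')%N -> near k' `<=` near k.
  elim: k' => [|k' IH]; first by rewrite leqn0 => /eqP ->.
  rewrite leq_eqVlt => /predU1P[->//|]; rewrite ltnS => /IH.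
  by apply: subset_trans.
have FF : Filter (filter_from setT near).
  apply: filter_from_filter; first by exists 0%N.
  move=> i j _ _; exists (maxn i j) => // y yij.
  by split; apply: near_le yij; [exact: leq_maxl|exact: leq_maxr].
have : filter_from setT near --> x.
  apply: cvg_ptws => t V oV Vx; have [k kV] := level_fine g oV Vx.
  by exists k => // y [c [kc xc yc]]; exact: (kV c).
move=> /(_ U (open_nbhs_nbhs (conj oU Ux)))[k _ kU].
by exists k => c kc xc y yc; apply: kU; exists c.
Qed.

(** The union [inner U k] of the level-k cells inside an open set U increases to
    U with k. The two processes agree on it by countable additivity, hence on U
    by continuity along increasing unions, hence everywhere, as open sets form a
    pi-system. *)
Lemma cylinders_determine_law (mu nu : process R A) :
  (forall i c, scales i -> codes i c -> mu (cyl i c) = nu (cyl i c)) ->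
  same_law mu nu.
Proof.
move=> mn.
pose inside U k := [set c | codes (level g k) c /\ cyl (level g k) c `<=` U].
pose inner U k := \bigcup_(c in inside U k) cyl (level g k) c.
have inner_homo U : {homo inner U : k k' / (k <= k')%N >-> (k <= k')%O}.
  apply/nondecreasing_seqP => k; apply/subsetPset => y [c [kc cU] yc].
  have [c1 kc1 yc1] := cyl_cover (level g k.+1) y.
  have [c2 kc2 c12] := level_refine kc1.
  (* The partitions are nested: the finer cell of [y] lies in its coarser cell. *)
  have c2E : c2 = c.
    by apply: (cyl_disjoint kc2 kc); exists y; split=> //; exact: c12.
  exists c1 => //; split=> // z /c12; rewrite c2E; exact: cU.
have innerE U : open U -> \bigcup_k inner U k = U.
  move=> oU; apply/seteqP; split=> [y [k _ [c [_ cU] /cU]]//|x Ux].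
  have [k kU] := cyl_base oU Ux; have [c kc xc] := cyl_cover (level g k) x.
  by exists k => //; exists c => //; split=> //; exact: kU.
have minner U k : measurable (inner U k).
  by apply: countable_bigcup_measurable => c _; exact: measurable_cyl.
have muE U k : mu (inner U k) = nu (inner U k).
  have tr : trivIset (inside U k) (cyl (level g k)).
    by apply: sub_trivIset (@cyl_disjoint _) => c [].
  rewrite /inner !measure_bigcup_esum//;
    try by move=> c _; exact: measurable_cyl.
  by apply: eq_esum => c [kc _]; apply: mn => //; exact: level_scale.
apply: (@g_sigma_algebra_measure_unique _ _ (borel (infwords A))
  (@open (infwords A)) _ (fun=> setT)).
- by move=> U oU; exact: sub_sigma_algebra.
- by move=> _; exact: openT.
- by rewrite bigcup_const.
- by move=> U V; exact: openI.
- move=> U oU; rewrite -(innerE U oU).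
  have := @nondecreasing_cvg_mu _ _ _ mu (inner U) (minner U) _ (@inner_homo U).
  have := @nondecreasing_cvg_mu _ _ _ nu (inner U) (minner U) _ (@inner_homo U).
  rewrite (_ : nu \o inner U = mu \o inner U); last by apply/funext => k /=.
  have mU : measurable (\bigcup_n inner U n) by exact: bigcup_measurable.
  by move=> /(_ mU) cn /(_ mU) cm; exact: (cvg_unique _ cm cn).
- by move=> _; exact: fin_num_fun_lty.
Qed.

End grid_theory.

(** * Distances between samples and processes *)

Lemma esumZl (R : realType) (T : choiceType) (D : set T) (k : R)
    (f : T -> \bar R) : 0 < k -> (forall i, 0 <= f i)%E ->
  (\esum_(i in D) (k%:E * f i) = k%:E * \esum_(i in D) f i)%E.
Proof.
have le_esumZl (l : R) (h : T -> \bar R) : 0 < l -> (forall i, 0 <= h i)%E ->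
    (\esum_(i in D) (l%:E * h i) <= l%:E * \esum_(i in D) h i)%E.
  move=> l0 h0; apply: ge_ereal_sup => _ [X [finX XD] <-].
  rewrite -ge0_mule_fsumr// lee_pmul2l ?lte_fin//.
  by apply: ereal_sup_ubound; exists X.
move=> k0 f0; apply/eqP; rewrite eq_le le_esumZl//=.
have kV : 0 < k^-1 by rewrite invr_gt0.
rewrite -lee_pdivlMl//; apply: le_trans (le_esumZl _ _ kV _); last first.
  by move=> i; rewrite mule_ge0// lee_fin ltW.
by apply: le_esum => i Di; rewrite muleA -EFinM mulVf ?mul1e// lt0r_neq0.
Qed.

Section grid_distance.
Variables (R : realType) (A : ptopologicalType) (g : grid R A).
Implicit Types (a b : scale g * code g -> R) (rho : process R A).

Definition cells : set (scale g * code g) := @scales _ _ g `*`` @codes _ _ g.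

Definition grid_dist a b : \bar R := \esum_(q in cells) `|a q - b q|%:E.

Definition empirical_profile (x : seq A) q : R :=
  weights q.1 * freq R x (@cell _ _ g q.1 q.2).

Definition law_profile rho q : R :=
  weights q.1 * fine (rho (@cyl _ _ g q.1 q.2)).

Lemma grid_distC a b : grid_dist a b = grid_dist b a.
Proof. by apply: eq_esum => q _; rewrite distrC. Qed.

Lemma grid_dist_triangle a b c :
  (grid_dist a c <= grid_dist a b + grid_dist b c)%E.
Proof.
rewrite /grid_dist -esumD; try by move=> q _; rewrite lee_fin.
by apply: le_esum => q _; rewrite -EFinD lee_fin; exact: ler_distD.
Qed.

(** Flattening the double sum over partitions and their cells is what allows
    Scheffe's lemma to be applied once, to all partitions simultaneously. *)
Lemma esum_cells (f : forall i, code g -> R) :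
  (forall i c, 0 <= f i c) ->
  (\esum_(q in cells) (weights q.1 * f q.1 q.2)%:E =
   \esum_(i in @scales _ _ g) ((weights i)%:E * \esum_(c in codes i) (f i c)%:E))%E.
Proof.
move=> f0; rewrite -(esum_esum (a := fun i c => (weights i * f i c)%:E)).
  apply: eq_esum => i si; under eq_esum do rewrite EFinM.
  by rewrite esumZl ?weights_gt0// => c; rewrite lee_fin.
by move=> i c si _; rewrite lee_fin mulr_ge0 ?f0// ltW ?weights_gt0.
Qed.

Lemma esum_freq_le1 (x : seq A) i :
  (\esum_(c in codes i) (freq R x (@cell _ _ g i c))%:E <= 1)%E.
Proof.
apply: ge_ereal_sup => _ [X [finX Xi] <-].
rewrite fsbig_finite//= sumEFin lee_fin; apply: sum_freq_le1 => y.
have notin c : c \in fset_set X -> ~ cell c y -> \1_(cell c) y = 0 :> R.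
  by move=> _ yc; rewrite indicE memNset.
have [[c [Xc yc]]|no] :=
  pselect (exists c, c \in fset_set X /\ cell c y); last first.
  by rewrite big1_seq// => c /andP[_ Xc]; apply: notin => // yc; apply: no; exists c.
rewrite (bigD1_seq c)//= ?fset_uniq// big1_seq ?addr0.
  by rewrite indicE lern1 leq_b1.
move=> c' /andP[c'c Xc']; apply: notin => // yc'; move/eqP: c'c; apply.
apply: (@cell_disjoint _ _ g i); last by exists y.
- by apply: Xi; move: Xc'; rewrite in_fset_set// inE.
- by apply: Xi; move: Xc; rewrite in_fset_set// inE.
Qed.

Lemma esum_law rho i : scales i ->
  (\esum_(c in codes i) (fine (rho (@cyl _ _ g i c)))%:E = 1)%E.
Proof.
move=> si; rewrite -[RHS](probability_setT rho).
have -> : setT = \bigcup_(c in codes i) @cyl _ _ g i c.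
  by apply/esym/seteqP; split=> // x _; have [c ic xc] := cyl_cover i x; exists c.
rewrite measure_bigcup_esum.
- apply: eq_esum => c _; rewrite fineK//; apply: fin_num_measure.
  exact: measurable_cyl.
- by move=> c _; exact: measurable_cyl.
- exact: cyl_disjoint.
Qed.

(** Convergence on each of the countably many cells holds almost surely for all
    cells together; the limit has the total mass of the weights, because the
    cells of each partition cover the space. *)
Lemma empirical_profile_cvg rho : stationary rho -> ergodic rho ->
  {ae rho, forall x : infwords A, forall e : R, 0 < e ->
    \forall n \near \oo,
      (grid_dist (empirical_profile (mkseq x n)) (law_profile rho) < e%:E)%E}.
Proof.
move=> srho erho.
have : {ae rho, forall x : infwords A, forall m,
    if (choice.unpickle m : option (scale g * code g)) is Some q then cells q ->
      empirical_profile (mkseq x n) q @[n --> \oo] --> law_profile rho q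
    else True}.
  apply: ae_foralln => m; case: choice.unpickle => [q|]; last by apply: aeW.
  have [cq|ncq] := pselect (cells q); last by apply: aeW.
  have [q1 q2] := cq.
  have := freq_cvg_law srho erho (width_gt0 q1) (@measurable_cell _ _ g q.1 q.2).
  apply: (@filterS _ _ (ae_filter_ringOfSetsType rho)) => x xcvg _.
  exact: cvgMr.
apply: (@filterS _ _ (ae_filter_ringOfSetsType rho)) => x xcvg e e0.
have law0 q : cells q -> 0 <= law_profile rho q.
  by move=> [q1 _]; rewrite mulr_ge0 ?fine_ge0// ltW// weights_gt0.
have mass : (\esum_(q in cells) (law_profile rho q)%:E =
    \esum_(i in @scales _ _ g) (weights i)%:E)%E.
  rewrite (esum_cells (f := fun i c => fine (rho (cyl i c)))).
    by apply: eq_esum => i si; rewrite esum_law// mule1.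
  by move=> i c; exact: fine_ge0.
apply: scheffe => //.
- by move=> n q [q1 _]; rewrite mulr_ge0 ?freq_ge0// ltW// weights_gt0.
- by rewrite mass; exact: weights_summable.
- move=> n; rewrite mass.
  rewrite (esum_cells (f := fun i c => freq R (mkseq x n) (@cell _ _ g i c))).
    apply: le_esum => i si; rewrite -[leRHS]mule1 lee_pmul2l// ?lte_fin ?weights_gt0//.
    exact: esum_freq_le1.
  by move=> i c; exact: freq_ge0.
- by move=> q cq; have := xcvg (choice.pickle q); rewrite choice.pickleK; exact.
Qed.

Lemma law_profile_dist_gt0 (mu nu : process R A) : ~ same_law mu nu ->
  (0 < grid_dist (law_profile mu) (law_profile nu))%E.
Proof.
move=> mn; rewrite lt0e esum_ge0 ?andbT; last by move=> q _; rewrite lee_fin.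
apply/eqP => d0; apply: mn; apply: cylinders_determine_law => i c si ic.
have : (`|law_profile mu (i, c) - law_profile nu (i, c)|%:E <= 0)%E.
  rewrite -d0; apply: esum_ge; exists [set (i, c)].
    by split=> // _ ->.
  by rewrite fsbig_set1.
rewrite lee_fin normr_le0 subr_eq0 /law_profile/=.
move=> /eqP e; have fineE := mulfI (lt0r_neq0 (weights_gt0 si)) e.
have fin (rho : process R A) : rho (@cyl _ _ g i c) \is a fin_num.
  by apply: fin_num_measure; exact: measurable_cyl.
by rewrite -(fineK (fin mu)) -(fineK (fin nu)) fineE.
Qed.

End grid_distance.
Arguments empirical_profile {R A} g x q.
Arguments law_profile {R A} g rho q.

Lemma ae_distribution d d' (T : measurableType d) (T' : measurableType d')
    (R : realType) (P : probability T R) (X : {mfun T >-> T'})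
    (mu : {measure set T' -> \bar R}) (Q : T' -> Prop) :
  (forall B, measurable B -> distribution P X B = mu B) ->
  {ae mu, forall x, Q x} -> {ae P, forall w, Q (X w)}.
Proof.
move=> PX [N [mN N0 QN]]; exists (X @^-1` N); split.
- by rewrite -[X in measurable X]setTI; exact: measurable_funPT.
- by rewrite -N0 -PX.
- by move=> w /= nQ; apply: QN.
Qed.

(** * Consistency for an arbitrary grid *)

(** Almost sure convergence of each sample is a property of its marginal, and
    finitely many almost sure events intersect in an almost sure event: this is
    how an arbitrary joint distribution is handled. The threshold is half a
    positive lower bound of the distances between distinct processes. *)
Lemma farthest_point_consistent (R : realType) (A : ptopologicalType)
    (g : grid R A) (N kappa : nat) (rho : 'I_kappa -> process R A)
    (disp : measure_display) (Omega : measurableType disp)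
    (P : probability Omega R)
    (X : 'I_N -> {mfun Omega >-> borel (infwords A)})
    (G : 'I_kappa -> {set 'I_N}) :
  (forall j, stationary (rho j)) -> (forall j, ergodic (rho j)) ->
  (forall j j', j != j' -> ~ same_law (rho j) (rho j')) ->
  (forall i, exists j, same_law (distribution P (X i)) (rho j)) ->
  (forall j, G j != finset.set0) ->
  (forall i j, i \in G j <-> same_law (distribution P (X i)) (rho j)) ->
  {ae P, forall w, exists n0 : nat, forall n : 'I_N -> nat,
    (forall i, (n0 <= n i)%N) ->
    forall out : {set {set 'I_N}},
      farthest_point_output kappa (fun i i' => grid_dist
        (empirical_profile g (mkseq (X i w) (n i)))
        (empirical_profile g (mkseq (X i' w) (n i')))) out ->
      out = [set G j | j : 'I_kappa]%SET}.
Proof.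
move=> srho erho rho_distinct X_marginal G_nonempty G_target.
have [cls clsP] := choice X_marginal.
have G_cls j : G j = [set i | cls i == j]%SET.
  apply/setP => i; rewrite inE; apply/idP/eqP => [/G_target ij|<-].
    apply/eqP; apply: contraPT isT => /rho_distinct; case => B mB.
    by rewrite -clsP// ij.
  exact/G_target.
have cls_surj j : exists i, cls i = j.
  have /set0Pn[i] := G_nonempty j.
  by rewrite G_cls inE => /eqP; exists i.
pose D j j' := grid_dist (law_profile g (rho j)) (law_profile g (rho j')).
have [del del0 delD] : exists2 del : R, 0 < del &
    forall j j', j != j' -> (del%:E <= D j j')%E.
  (* The cap at 1 keeps the minimum finite when there is a single process. *)
  pose m := \big[mine/1%E]_(p : 'I_kappa * 'I_kappa | p.1 != p.2) D p.1 p.2.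
  have m0 : (0 < m)%E.
    rewrite /m; elim/big_ind: _ => // [x y x0 y0|p /rho_distinct].
      by rewrite lt_min x0.
    exact: law_profile_dist_gt0.
  have m1 : (m <= 1)%E by exact: bigmin_le_id.
  have mfin : m \is a fin_num.
    by rewrite ge0_fin_numE ?(ltW m0)//; exact: le_lt_trans m1 (ltry _).
  exists (fine m); first by rewrite fine_gt0// m0; exact: le_lt_trans m1 (ltry _).
  by move=> j j' jj'; rewrite fineK// /m (bigD1 (j, j'))//= ge_min lexx.
have del4 : 0 < del / 4%:R by rewrite divr_gt0.
have : {ae P, forall w, forall i e, 0 < e -> \forall n \near \oo,
    (grid_dist (empirical_profile g (mkseq (X i w) n))
       (law_profile g (rho (cls i))) < e%:E)%E}.
  apply: filter_forall => i.
  exact: (ae_distribution (clsP i) (empirical_profile_cvg g _ _)).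
apply: filterS => w near_law.
have n0_ex i : exists m, forall n, (m <= n)%N ->
    (grid_dist (empirical_profile g (mkseq (X i w) n))
       (law_profile g (rho (cls i))) < (del / 4%:R)%:E)%E.
  by have [m _ mP] := near_law i _ del4; exists m => n mn; exact: mP.
have [n0 n0P] := choice n0_ex.
exists (\max_i n0 i)%N => n n0n out.
set f := fun i => empirical_profile g (mkseq (X i w) (n i)).
have f_law i : (grid_dist (f i) (law_profile g (rho (cls i))) <
    (del / 4%:R)%:E)%E.
  by apply: n0P; exact: leq_trans (leq_bigmax i) (n0n i).
have f_law' i : (grid_dist (law_profile g (rho (cls i))) (f i) <
    (del / 4%:R)%:E)%E by rewrite grid_distC.
move=> outP.
rewrite (farthest_point_separated (t := (del / 2%:R)%:E) cls_surj _ _ outP).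
- by apply: eq_imset => j; rewrite G_cls.
- move=> i i' ii'.
  apply: le_lt_trans (grid_dist_triangle _ (law_profile g (rho (cls i))) _) _.
  rewrite {2}ii' [in ltRHS](_ : del / 2%:R = del / 4%:R + del / 4%:R); last lra.
  by rewrite EFinD; apply: lteD; [exact: f_law|exact: f_law'].
- move=> i i' ii'; rewrite leNgt; apply/negP => ff'.
  have := delD _ _ ii'; rewrite leNgt => /negP; apply.
  apply: le_lt_trans (grid_dist_triangle _ (f i) _) _.
  rewrite [in ltRHS](_ : del = del / 4%:R + (del / 2%:R + del / 4%:R)); last lra.
  rewrite EFinD; apply: lteD; first exact: f_law'.
  apply: le_lt_trans (grid_dist_triangle _ (f i') _) _.
  by rewrite EFinD; apply: lteD; [exact: ff'|exact: f_law].
Qed.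

(** * Weights *)

Section weights.
Variable R : realType.

Lemma weight_gt0 k : (0 < k)%N -> 0 < weight R k.
Proof. by move=> k0; rewrite invr_gt0 ltr0n muln_gt0 k0. Qed.

Lemma weight_ge0 k : 0 <= weight R k.
Proof. by rewrite invr_ge0. Qed.

(** The partial sums telescope, since 1/(k(k+1)) = 1/k - 1/(k+1). *)
Lemma esum_weight_le1 :
  (\esum_(k in [set k | (0 < k)%N]) (weight R k)%:E <= 1)%E.
Proof.
rewrite -nneseries_esum; last by move=> k _; rewrite lee_fin weight_ge0.
have partial n : \sum_(0 <= k < n | (0 < k)%N) weight R k <= 1.
  suff -> : \sum_(0 <= k < n | (0 < k)%N) weight R k =
      if n is m.+1 then 1 - m.+1%:R^-1 else 0.
    by case: n => // m; rewrite lerBlDr lerDl invr_ge0.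
  elim: n => [|n IH]; first by rewrite big_nil.
  rewrite big_mkcond big_nat_recr//= -big_mkcond IH.
  case: n {IH} => [|n]; first by rewrite invr1 subrr addr0.
  rewrite /= /weight natrM -addrA; congr (1 + _).
  have n1 : n.+1%:R != 0 :> R by rewrite pnatr_eq0.
  have n2 : n.+2%:R != 0 :> R by rewrite pnatr_eq0.
  rewrite -[n.+2%:R]natr1 in n2 *; field; by apply/andP.
apply: lime_le.
  by apply: is_cvg_nneseries_cond => k _ _; rewrite lee_fin weight_ge0.
by apply: nearW => n; rewrite sumEFin lee_fin.
Qed.

Lemma eseries_from1 (f : nat -> \bar R) : (forall k, 0 <= f k)%E ->
  (\sum_(1 <= k <oo) f k = \esum_(k in [set k | (0 < k)%N]) f k)%E.
Proof. by move=> f0; rewrite eseries_cond/= nneseries_esum. Qed.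

End weights.


(** * The dyadic cubes *)

Lemma trivIset_set_inj (T I : Type) (D : set I) (F : I -> set T) :
  trivIset D F -> (forall i, D i -> F i !=set0) -> set_inj D F.
Proof.
move=> tF F0 i j /set_mem Di /set_mem Dj Fij; apply: tF => //.
by rewrite -Fij setIid; exact: F0.
Qed.

Lemma grid_dist_empirical (R : realType) (A : ptopologicalType) (g : grid R A)
    (x y : seq A) :
  grid_dist (empirical_profile g x) (empirical_profile g y) =
  (\esum_(i in @scales _ _ g) ((weights i)%:E * \esum_(c in codes i)
     `|freq R x (@cell _ _ g i c) - freq R y (@cell _ _ g i c)|%:E))%E.
Proof.
rewrite -(esum_cells (f := fun i c =>
  `|freq R x (@cell _ _ g i c) - freq R y (@cell _ _ g i c)|)); last by [].
apply: eq_esum => q [q1 _].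
by rewrite -mulrBr normrM (gtr0_norm (weights_gt0 q1)).
Qed.

Lemma measurable_coordinate (A : ptopologicalType) k (V : 'I_k -> set A) :
  (forall u, measurable (V u : set (borel A))) ->
  measurable ([set x | forall u, V u (x u)] : set (borel (words A k))).
Proof.
move=> mV.
rewrite (_ : [set x | _] = \bigcap_(u in setT) [set x : words A k | V u (x u)]).
  apply: fin_bigcap_measurable => // u _; rewrite -[X in measurable X]setTI.
  have cont : continuous ((fun x => x u) : words A k -> A).
    exact: (@proj_continuous 'I_k (fun=> A) u).
  exact: (continuous_borel_measurable cont measurableT (mV u)).
by apply/seteqP; split=> x /= xV u; move: (xV u) => //; apply.
Qed.

Section real_grid.
Variable R : realType.
Implicit Types (s : seq int).

(** The corner of a cube is a list of integers; only lists of length m are used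
    as codes, so that each cube has exactly one code. *)
Definition coded_cube m l s : set (words R m) := cube l (fun u => s`_u).
Arguments coded_cube : clear implicits.

(** Reading off the corner of the cube through the integer part makes
    disjointness and covering immediate. *)
Lemma cubeP m l (z : 'I_m -> int) (x : 'I_m -> R) :
  cube l z x <-> forall u, Num.floor (x u * 2 ^+ l) = z u.
Proof.
have l0 : (0 : R) < 2 ^+ l by rewrite exprn_gt0.
split=> [xz u|xz u].
  by apply: floor_def; have := xz u; rewrite ler_pdivrMr// ltr_pdivlMr.
by rewrite ler_pdivrMr// ltr_pdivlMr// -xz floor_itv.
Qed.

Lemma measurable_cube m l s :
  measurable (coded_cube m l s : set (borel (words R m))).
Proof.
apply: (@measurable_coordinate R m (fun u => [set r |
  (s`_u)%:~R / 2 ^+ l <= r < (s`_u + 1)%:~R / 2 ^+ l])) => u.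
set a := _ / _; set b := _ / _.
rewrite (_ : [set r | _] = ~` `]-oo, a[%classic `&` `]-oo, b[%classic).
  apply: measurableI; first apply: measurableC.
    by apply: sub_sigma_algebra; exact: lray_open.
  by apply: sub_sigma_algebra; exact: lray_open.
apply/seteqP; split=> r /=; rewrite !in_itv/=.
  by move=> /andP[ar rb]; split=> //; apply/negP; rewrite -leNgt.
by move=> [/negP]; rewrite -leNgt => -> ->.
Qed.

Lemma coded_cube_disjoint m l : trivIset [set s | size s = m] (coded_cube m l).
Proof.
move=> s s' /= sm sm' [x [/cubeP xs /cubeP xs']].
apply: (@eq_from_nth _ 0); first by rewrite sm sm'.
move=> u; rewrite sm => um.
by rewrite -(xs (Ordinal um)) -(xs' (Ordinal um)).
Qed.

Lemma coded_cube_cover m l :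
  \bigcup_(s in [set s | size s = m]) coded_cube m l s = setT.
Proof.
apply/seteqP; split=> // x _.
exists [seq Num.floor (x u * 2 ^+ l) | u <- enum 'I_m].
  by rewrite /= size_map size_enum_ord.
apply/cubeP => u; rewrite (nth_map u) ?size_enum_ord// nth_ord_enum//.
Qed.

(** Halving the integer coordinates of the corner gives the dyadic parent. *)
Lemma coded_cube_refine m l s : size s = m.+1 -> exists2 s', size s' = m &
  @block_event R _ (coded_cube m.+1 l.+1 s) 0 `<=`
  @block_event R _ (coded_cube m l s') 0.
Proof.
move=> sm; exists (mkseq (fun u => (s`_u %/ 2)%Z) m); first exact: size_mkseq.
move=> x /cubeP xs; apply/cubeP => u; rewrite nth_mkseq//.
have := xs (widen_ord (leqnSn m) u); rewrite /block/= => <-.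
set r := x _; have l0 : (0 : R) < 2 ^+ l by rewrite exprn_gt0.
rewrite exprS mulrCA; move: (r * _) => {}r {l0}.
apply: floor_def; have /andP[] := floor_itv (2 * r).
set z := Num.floor _ => z1 z2.
have d1 : (z %/ 2)%Z * 2 <= z by exact: lez_floor.
have d2 : z + 1 <= ((z %/ 2)%Z + 1) * 2 by rewrite lezD1 ltz_ceil.
rewrite -(ler_int R) intrM in d1; rewrite -(ler_int R) intrM in d2.
by apply/andP; split; lra.
Qed.

Lemma coded_cube_fine (x : infwords R) t (V : set R) : open V -> V (x t) ->
  exists k, forall s,
    @block_event R _ (coded_cube k.+1 k.+1 s) 0 x ->
    @block_event R _ (coded_cube k.+1 k.+1 s) 0 `<=` [set y | V (y t)].
Proof.
move=> oV Vx.
have [e /= e0 eV] : \forall e \near 0^'+, ball (x t) e `<=` V.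
  exact: open_subball.
(* The ball of radius [e] itself need not be inside V: only radii close to 0,
   and different from [e], are known to be good. *)
have e2 : 0 < e / 2 by rewrite divr_gt0.
have {e0 eV e2} [d d0 dV] : exists2 d : R, 0 < d & ball (x t) d `<=` V.
  exists (e / 2) => //; apply: eV => //=.
  by rewrite sub0r normrN gtr0_norm// ltr_pdivrMr// ltr_pMr// ltr1n.
(* Level k must see the coordinate t and have cubes of side less than d. *)
pose k := maxn t (Num.bound d^-1).
have P0 : (0 : R) < 2 ^+ k.+1 by rewrite exprn_gt0.
have Pd : (2 ^+ k.+1)^-1 < d.
  rewrite invf_plt//; apply: lt_le_trans (archi_boundP _) _.
    by rewrite invr_ge0 ltW.
  rewrite -natrX ler_nat; apply: leq_trans (ltnW (ltn_expl _ (ltnSn 1))).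
  by rewrite leqW// leq_maxr.
exists k => s /cubeP xs y /cubeP ys; apply: dV; rewrite /ball/=.
have tk : (t < k.+1)%N by rewrite ltnS leq_maxl.
have := xs (Ordinal tk); rewrite -(ys (Ordinal tk)) /block/= add0n.
have /andP[] := floor_itv (x t * 2 ^+ k.+1).
have /andP[] := floor_itv (y t * 2 ^+ k.+1).
set fx := Num.floor (x t * _); set fy := Num.floor (y t * _).
rewrite !intrD => y1 y2 x1 x2 fxy; rewrite fxy in x1 x2.
apply: lt_trans Pd; rewrite -(ltr_pM2r P0) mulVf ?gt_eqF//.
rewrite -[X in _ * X < _](gtr0_norm P0) -normrM mulrBl ltr_norml.
by apply/andP; split; lra.
Qed.

Lemma real_weights_summable :
  (\esum_(q in [set q : nat * nat | (0 < q.1)%N /\ (0 < q.2)%N])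
    (weight R q.1 * weight R q.2)%:E < +oo)%E.
Proof.
rewrite (_ : [set q | _] = [set k | (0 < k)%N] `*`` (fun=> [set k | (0 < k)%N])).
  rewrite -(esum_esum (a := fun m l => (weight R m * weight R l)%:E)); last first.
    by move=> m l _ _; rewrite lee_fin mulr_ge0 ?weight_ge0.
  apply: (@le_lt_trans _ _ 1%E); last exact: ltry.
  apply: le_trans (esum_weight_le1 R); apply: le_esum => m m0.
  under eq_esum do rewrite EFinM.
  rewrite esumZl ?weight_gt0//; last by move=> l; rewrite lee_fin weight_ge0.
  rewrite -[leRHS]mule1 lee_pmul2l ?lte_fin ?weight_gt0//.
  exact: esum_weight_le1.
by apply/seteqP; split.
Qed.

Definition real_grid : grid R R := @Grid R R (nat * nat)%type (seq int)
  [set q | (0 < q.1)%N /\ (0 < q.2)%N]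
  (fun q => weight R q.1 * weight R q.2) fst (fun q => [set s | size s = q.1])
  (fun q => coded_cube q.1 q.2)
  (fun q => fun '(conj m0 l0) => mulr_gt0 (weight_gt0 R m0) (weight_gt0 R l0))
  real_weights_summable (fun q => @proj1 _ _)
  (fun q => @measurable_cube q.1 q.2) (fun q => @coded_cube_disjoint q.1 q.2)
  (fun q => coded_cube_cover q.1 q.2)
  (fun k => (k.+1, k.+1)) (fun k => conj (ltn0Sn k) (ltn0Sn k))
  (fun k s => @coded_cube_refine k.+1 k.+1 s)
  (fun x t V oV Vx =>
     let: ex_intro k kV := coded_cube_fine oV Vx in
     ex_intro _ k (fun s _ => kV s)).

Lemma dhat_realE (x y : seq R) : dhat_real x y =
  grid_dist (empirical_profile real_grid x) (empirical_profile real_grid y).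
Proof.
have dist0 m l : (0 <= \esum_(B in @cubes R m l)
    `|freq R x B - freq R y B|%:E)%E by apply: esum_ge0.
have term0 m l : (0 <= (weight R m * weight R l)%:E *
    \esum_(B in @cubes R m l) `|freq R x B - freq R y B|%:E)%E.
  by rewrite mule_ge0// lee_fin mulr_ge0 ?weight_ge0.
rewrite grid_dist_empirical /dhat_real eseries_from1; last first.
  by move=> m; apply: nneseries_ge0 => l _ _.
rewrite (eq_esum (fun m _ => eseries_from1 (term0 m))) esum_esum//.
have -> : @scales _ _ real_grid =
    [set k | (0 < k)%N] `*`` (fun=> [set k | (0 < k)%N]) by apply/seteqP; split.
apply: eq_esum => -[m l] [m0 l0] /=; congr (_ * _)%E.
have -> : @cubes R m l = coded_cube m l @` [set s | size s = m].
  apply/seteqP; split=> [_ [z _ <-]|_ [s _ <-]]; last by exists (fun u => s`_u).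
  exists [seq z u | u <- enum 'I_m]; first by rewrite /= size_map size_enum_ord.
  congr cube; apply/funext => u.
  by rewrite (nth_map u) ?size_enum_ord// nth_ord_enum.
rewrite esum_image//; apply: trivIset_set_inj (@coded_cube_disjoint m l) _.
move=> s _; exists (fun u => (s`_u)%:~R / 2 ^+ l); apply/cubeP => u.
by rewrite divfK ?intrKfloor ?expf_neq0.
Qed.

End real_grid.

(** * Words over a finite alphabet *)

Section finite_grid.
Variables (R : realType) (F : finType) (x0 : F).
Local Notation A := (finite_letters x0).
Implicit Types (s : seq F).

Definition spelled k s : set (words A k) :=
  [set x | forall u : 'I_k, x u = nth x0 s u].

Lemma open_finite_letters (V : set A) : open V.
Proof. exact: discrete_open. Qed.

Lemma measurable_spelled k s :
  measurable (@spelled k s : set (borel (words A k))).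
Proof.
apply: (@measurable_coordinate A k (fun u => [set a | a = nth x0 s u])) => u.
by apply: sub_sigma_algebra; exact: open_finite_letters.
Qed.

Lemma spelled_disjoint k : trivIset [set s | size s = k] (@spelled k).
Proof.
move=> s s' /= sk sk' [x [xs xs']].
apply: (@eq_from_nth _ x0); first by rewrite sk sk'.
move=> u; rewrite sk => uk.
by rewrite -(xs (Ordinal uk)) -(xs' (Ordinal uk)).
Qed.

Lemma spelled_codom k (x : words A k) : spelled [seq x u | u <- enum 'I_k] x.
Proof. by move=> u; rewrite (nth_map u) ?size_enum_ord// nth_ord_enum. Qed.

Lemma spelled_cover k :
  \bigcup_(s in [set s | size s = k]) @spelled k s = setT.
Proof.
apply/seteqP; split=> // x _; exists [seq x u | u <- enum 'I_k].
  by rewrite /= size_map size_enum_ord.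
exact: spelled_codom.
Qed.

Lemma spelled_refine k s : size s = k.+1 -> exists2 s', size s' = k &
  @block_event A _ (@spelled k.+1 s) 0 `<=` @block_event A _ (@spelled k s') 0.
Proof.
move=> sk; exists (take k s); first by rewrite size_take sk ltnSn.
by move=> x xs u; rewrite nth_take//; exact: (xs (widen_ord (leqnSn k) u)).
Qed.

Lemma spelled_fine (x : infwords A) t (V : set A) : open V -> V (x t) ->
  exists k, forall s,
    @block_event A _ (@spelled k.+1 s) 0 x ->
    @block_event A _ (@spelled k.+1 s) 0 `<=` [set y | V (y t)].
Proof.
move=> _ Vx; exists t => s xs y ys /=.
have := xs ord_max; rewrite -(ys ord_max) /block/= add0n => xy.
by rewrite -xy.
Qed.

Definition finite_grid : grid R A := @Grid R A nat (seq F)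
  [set k | (0 < k)%N] (weight R) id (fun k => [set s | size s = k]) spelled
  (fun k k0 => weight_gt0 R k0)
  (le_lt_trans (esum_weight_le1 R) (ltry 1)) (fun k k0 => k0)
  measurable_spelled spelled_disjoint spelled_cover
  succn ltn0Sn
  (fun k s => @spelled_refine k.+1 s)
  (fun x t V oV Vx =>
     let: ex_intro k kV := spelled_fine oV Vx in
     ex_intro _ k (fun s _ => kV s)).

Lemma dhat_finiteE (x y : seq A) : dhat_finite R x y =
  grid_dist (empirical_profile finite_grid x) (empirical_profile finite_grid y).
Proof.
rewrite grid_dist_empirical /dhat_finite eseries_from1; last first.
  by move=> k; rewrite mule_ge0 ?sume_ge0// lee_fin weight_ge0.
apply: eq_esum => k _; congr (_ * _)%E.
pose code_of (b : {ffun 'I_k -> F}) := [seq b u | u <- enum 'I_k].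
have cellE b : @spelled k (code_of b) = [set (b : 'I_k -> F)].
  apply/seteqP; split=> [z zb|_ ->]; last exact: spelled_codom.
  by apply/funext => u; rewrite zb -spelled_codom.
have code_inj : injective code_of.
  move=> b b' bb'; apply/ffunP => u.
  by have := @spelled_codom k b u; rewrite -/(code_of b) bb' -spelled_codom.
have codesE : [set s | size s = k] = code_of @` setT.
  apply/seteqP; split=> [s sk|_ [b _ <-]]; last by rewrite /= size_map size_enum_ord.
  exists [ffun u : 'I_k => nth x0 s u] => //.
  apply: (@eq_from_nth _ x0); first by rewrite size_map size_enum_ord.
  rewrite size_map size_enum_ord => u uk.
  by rewrite (nth_map (Ordinal uk)) ?size_enum_ord// ffunE nth_enum_ord.
rewrite /= codesE esum_image; last by move=> b b' _ _; exact: code_inj.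
rewrite esum_fset//; last exact: finite_finset.
rewrite (@fsbigE _ _ _ _ _ (index_enum _)) ?index_enum_uniq//=; last first.
  by move=> b _; rewrite mem_index_enum.
by apply: eq_big => b; rewrite ?in_setT ?cellE.
Qed.

End finite_grid.

(** * Consistency of farthest-point clustering *)

Theorem theorem4p1 (R : realType) (a : alphabet) (N kappa : nat)
    (rho : 'I_kappa -> process R (letters R a))
    (rho_stationary : forall j, stationary (rho j))
    (rho_ergodic : forall j, ergodic (rho j))
    (rho_distinct : forall j j', j != j' -> ~ same_law (rho j) (rho j'))
    (disp : measure_display) (Omega : measurableType disp)
    (P : probability Omega R)
    (X : 'I_N -> {mfun Omega >-> borel (infwords (letters R a))})
    (X_marginal : forall i, exists j, same_law (distribution P (X i)) (rho j))
    (G : 'I_kappa -> {set 'I_N})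
    (G_nonempty : forall j, G j != finset.set0)
    (G_target : forall i j,
      i \in G j <-> same_law (distribution P (X i)) (rho j)) :
  {ae P, forall w, exists n0 : nat, forall n : 'I_N -> nat,
    (forall i, (n0 <= n i)%N) ->
    forall out : {set {set 'I_N}},
      farthest_point_output kappa
        (fun i i' => dhat (mkseq (X i w) (n i)) (mkseq (X i' w) (n i'))) out ->
      out = [set G j | j : 'I_kappa]%SET}.
Proof.
case: a rho rho_stationary rho_ergodic rho_distinct X X_marginal G_target
  => [|F x0] rho srho erho rho_distinct X X_marginal G_target.
- apply: filterS (farthest_point_consistent (real_grid R) srho erho rho_distinct
    X_marginal G_nonempty G_target) => w [n0 n0P].
  exists n0 => n /n0P out_eq out outP; apply: out_eq.
  congr farthest_point_output: outP.
  by apply/funext => i; apply/funext => i'; exact: dhat_realE.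
- apply: filterS (farthest_point_consistent (finite_grid R x0) srho erho
    rho_distinct X_marginal G_nonempty G_target) => w [n0 n0P].
  exists n0 => n /n0P out_eq out outP; apply: out_eq.
  congr farthest_point_output: outP.
  by apply/funext => i; apply/funext => i'; exact: dhat_finiteE.
Qed.
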